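(* Let $P$ be the uniform probability distribution on the equilateral triangle with vertices $(0,0)$, $(1,0)$, $(\frac12,\frac{\sqrt3}{2})$. Let $N\ge3$ be an integer and $n=N(N+1)/2$. Then the $n$th quantization error of $P$ satisfies \[V_n(P)\le \frac{45N^3-28\sqrt{21}N^2+(301-28\sqrt{21})N-98}{324N^3(N-1)^2},\] and this upper bound equals $\frac{5}{36N^2}-\frac{14\sqrt{21}-45}{162N^3}+O(N^{-4})$ as $N\to\infty$.
   Context: For a Borel probability measure $P$ on $\mathbb R^2$ with finite second moment and $n\ge1$, the $n$th quantization error is $V_n(P)=\inf\{\int \min_{a\in\alpha}\|x-a\|^2\,dP(x): \alpha\subset\mathbb R^2,\ \mathrm{card}(\alpha)\le n\}$, where $\|\cdot\|$ is the Euclidean norm. The uniform distribution on the triangle has density $\frac{4}{\sqrt3}$ on the triangle and $0$ elsewhere. *)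

(* Defs.v *)
From HB Require Import structures.
From mathcomp Require Import all_boot all_order all_algebra.
From mathcomp Require Import all_classical all_reals all_analysis.
Set Implicit Arguments. Unset Strict Implicit. Unset Printing Implicit Defensive.
Import Order.TTheory GRing.Theory Num.Theory.
Import numFieldNormedType.Exports.
Local Open Scope classical_set_scope.
Local Open Scope ring_scope.

Section Quant.
Variable R : realType.

Definition leb2 := (@lebesgue_measure R \x @lebesgue_measure R)%E.

Definition triangle : set (R * R) :=
  [set x | 0 <= x.2 /\ x.2 <= Num.sqrt 3 * x.1 /\ x.2 <= Num.sqrt 3 * (1 - x.1)].

Definition tri_density (x : R * R) : R :=
  if `[< triangle x >] then 4 / Num.sqrt 3 else 0.

Definition sqdist (x a : R * R) : R := (x.1 - a.1) ^+ 2 + (x.2 - a.2) ^+ 2.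

(* min_{a in alpha} ||x - a||^2 (= +oo for empty alpha). *)
Definition mindist (alpha : seq (R * R)) (x : R * R) : \bar R :=
  \big[Order.min/+oo%E]_(a <- alpha) (sqdist x a)%:E.

Definition distortion (alpha : seq (R * R)) : \bar R :=
  (\int[leb2]_(x in [set: R * R]) ((tri_density x)%:E * mindist alpha x))%E.

(* n-th quantization error: inf over alpha with card alpha <= n
   (finite sets represented by sequences of length <= n). *)
Definition Vn (n : nat) : \bar R :=
  ereal_inf [set distortion alpha | alpha in [set alpha : seq (R * R) | (size alpha <= n)%N]].

Definition tri_bound (N : nat) : R :=
  let s := Num.sqrt 21 in
  (45 * N%:R ^+ 3 - 28 * s * N%:R ^+ 2 + (301 - 28 * s) * N%:R - 98)
  / (324 * N%:R ^+ 3 * (N%:R - 1) ^+ 2).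

End Quant.

(* Main.v *)
Require Import Defs.
From HB Require Import structures.
From mathcomp Require Import all_boot all_order all_algebra.
From mathcomp Require Import all_classical all_reals all_analysis.
From mathcomp Require Import measurable_realfun ring lra zify.
Import Order.TTheory GRing.Theory Num.Theory.
Import numFieldNormedType.Exports.
Local Open Scope classical_set_scope.
Local Open Scope ring_scope.

(** The quantizers are the [N (N + 1) / 2] points of a triangular lattice of
    spacing [d] filling a concentric triangle at distance [e] from the sides.
    The given triangle splits into the [(N - 1) ^ 2] lattice triangles and, along
    each side, [N - 1] rectangles [d x e] and two right triangles with legs [e]
    and [sqrt 3 * e]; assigning every point to a nearest lattice point of its
    piece, the distortion is computed exactly.  With [E := 2 * sqrt 3 * e], the
    choice [E = sqrt 21 / (3 N)] minimizes the [N ^ -3] term and yields the bound.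

    The second moment of a triangle about a point comes from Tonelli's theorem
    and Simpson's rule, which is exact on the cubic slice integrals.  Additivity
    over pieces is only needed as subadditivity over a cover, so overlapping
    boundaries are harmless. *)

(** * Integration of cubics on an interval *)

Lemma integral_deriv_poly {R : realType} (p : {poly R}) (a b : R) : a <= b ->
  (\int[lebesgue_measure]_(x in `[a, b]) ((p^`()).[x])%:E = (p.[b] - p.[a])%:E)%E.
Proof.
rewrite le_eqVlt => /orP[/eqP<-|ab]; first by rewrite set_itv1 integral_set1 subrr.
rewrite (@continuous_FTC2 _ _ (horner p)) //.
- by apply/continuous_subspaceT => x; exact: continuous_horner.
- split.
  + by move=> x _; exact: derivable_horner.
  + by apply: cvg_at_right_filter; exact: continuous_horner.
  + by apply: cvg_at_left_filter; exact: continuous_horner.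
- by move=> x _; rewrite -derivE.
Qed.

(** The integrand is a function with listed coefficients rather than a polynomial: callers keep its
    geometric form and only exhibit the coefficients, which do not enter the value. *)
Lemma integral_simpson {R : realType} (c0 c1 c2 c3 : R) (f : R -> R) (a b : R) :
  (forall t, f t = c0 + c1 * t + c2 * t ^+ 2 + c3 * t ^+ 3) -> a <= b ->
  (\int[lebesgue_measure]_(x in `[a, b]) (f x)%:E =
   ((b - a) / 6 * (f a + 4 * f ((a + b) / 2) + f b))%:E)%E.
Proof.
move=> fE ab.
pose p : {poly R} := c0 *: 'X + (c1 / 2) *: 'X^2 + (c2 / 3) *: 'X^3 + (c3 / 4) *: 'X^4.
transitivity (\int[lebesgue_measure]_(x in `[a, b]) ((p^`()).[x])%:E)%E.
  apply: eq_integral => x _; congr (_%:E); rewrite fE /p !poly.derivE !hornerE /=.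
  by field.
rewrite integral_deriv_poly // !fE /p !hornerE /=; congr (_%:E); by field.
Qed.

(** * Second moment of a trapezoid with horizontal bases *)

Section Trapezoid.
Context {R : realType} (y0 y1 l0 l1 r0 r1 : R) (P : R * R).

Definition trapezoid : set (R * R) :=
  [set x | [/\ y0 <= x.2, x.2 <= y1, l0 + l1 * x.2 <= x.1 & x.1 <= r0 + r1 * x.2]].

(** The integral of [sqdist (x, y) P] over [x] in the horizontal slice at height [y]. It is cubic in
    [y], so Simpson's rule applies to it again. *)
Definition slice_moment (y : R) : R :=
  ((r0 + r1 * y - P.1) ^+ 3 - (l0 + l1 * y - P.1) ^+ 3) / 3
  + (r0 + r1 * y - (l0 + l1 * y)) * (y - P.2) ^+ 2.

Lemma measurable_le_aff (a b c : R) :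
  measurable [set x : R * R | a * x.1 + b * x.2 <= c].
Proof.
rewrite -[X in measurable X]setTI.
rewrite (_ : [set x : R * R | _] = (fun x : R * R => a * x.1 +
  b * x.2 <= c) @^-1` [set true]).
  apply: measurable_fun_ler => //.
  apply: measurable_funD; apply: measurable_funM => //.
by apply/seteqP; split => x.
Qed.

Lemma measurable_trapezoid : measurable trapezoid.
Proof.
rewrite (_ : trapezoid = [set x | 0 * x.1 + -1 * x.2 <= - y0] `&` [set x | 0 * x.1 +
  1 * x.2 <= y1]
  `&` [set x | -1 * x.1 + l1 * x.2 <= - l0] `&` [set x | 1 * x.1 + (- r1) * x.2 <= r0]).
  by repeat apply: measurableI; exact: measurable_le_aff.
apply/seteqP; split => -[x y] /=; rewrite /trapezoid /=.
  by move=> [] *; repeat split; lra.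
by move=> [[[]]] *; split; lra.
Qed.

Lemma measurable_sqdist : measurable_fun setT (fun x : R * R => (sqdist x P)%:E).
Proof.
apply/measurable_EFinP; rewrite /sqdist.
by apply: measurable_funD; apply: measurable_funX; apply: measurable_funB.
Qed.

Lemma integral_trapezoid : y0 <= y1 ->
  (forall y, y0 <= y <= y1 -> l0 + l1 * y <= r0 + r1 * y) ->
  (\int[@leb2 R]_(x in trapezoid) (sqdist x P)%:E =
   ((y1 - y0) / 6 * (slice_moment y0 + 4 * slice_moment ((y0 + y1) / 2) +
     slice_moment y1))%:E)%E.
Proof.
move=> y01 lr.
rewrite integral_mkcond /leb2.
rewrite fubini_tonelli2 /fubini_G /=; first last.
- by move=> x; apply: erestrict_ge0 => z _; rewrite lee_fin addr_ge0 ?sqr_ge0.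
- apply/(measurable_restrictT _ _).1; first exact: measurable_trapezoid.
  by apply: measurable_funTS; exact: measurable_sqdist.
transitivity (\int[lebesgue_measure]_(y in `[y0, y1]) (slice_moment y)%:E)%E.
  rewrite [RHS]integral_mkcond; apply: eq_integral => y _ /=.
  rewrite [RHS]patchE; case: ifPn => [|yn].
    rewrite inE /= in_itv /= => /andP[ya yb].
    transitivity (\int[lebesgue_measure]_(x in `[(l0 + l1 * y)%R, (r0 + r1 * y)%R])
      (sqdist (x,y) P)%:E)%E.
      rewrite [RHS]integral_mkcond; apply: eq_integral => x _ /=.
      rewrite !patchE; congr (if _ then _ else _).
      apply/idP/idP; rewrite !inE /= /trapezoid /= in_itv /=.
        by move=> [_ _ -> ->].
      by move=> /andP[].
    rewrite (integral_simpson (P.1 ^+ 2 + (y - P.2)^+2) (- 2 * P.1) 1 0); first last.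
    - by apply: lr; rewrite ya.
    - by move=> t; rewrite /sqdist /=; ring.
    by rewrite /sqdist /slice_moment /=; congr (_%:E); field.
  apply: integral0_eq => x _; rewrite patchE ifF //.
  apply: contraNF yn; rewrite !inE /= /trapezoid /= in_itv /=.
  by move=> [-> ->].
(* Expansion of the slice integral in powers of [y]: [A] and [C] are the slice ends at height zero
   measured from [P], and [K + L * y] is the width. *)
pose A := r0 - P.1; pose C := l0 - P.1; pose q := P.2.
pose K := r0 - l0; pose L := r1 - l1.
apply: (integral_simpson ((A^+3-C^+3)/3 + K * q^+2)
  (A^+2*r1 - C^+2* l1 + L * q^+2 - 2 * K * q) (A * r1^+2 - C * l1^+2 + K - 2 * L * q)
  ((r1^+3-l1^+3)/3 + L)) => // t.
by rewrite /slice_moment /A /C /q /K /L; field.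
Qed.

End Trapezoid.

(** * Triangles: mass bounds by second moments *)

Definition conv3 {R : realType} (A B C : R * R) : set (R * R) :=
  [set x | exists a b c : R, [/\ 0 <= a, 0 <= b, 0 <= c, a + b + c = 1 &
     x = (a * A.1 + b * B.1 + c * C.1, a * A.2 + b * B.2 + c * C.2)]].

(** Twice the signed area. *)
Definition det3 {R : realType} (A B C : R * R) : R :=
  (B.1 - A.1) * (C.2 - A.2) - (C.1 - A.1) * (B.2 - A.2).

(* The integral of [sqdist x P] over the triangle [A B C]. *)
Definition moment3 {R : realType} (P A B C : R * R) : R :=
  `|det3 A B C| / 24 * (sqdist A P + sqdist B P + sqdist C P
    + (A.1 + B.1 + C.1 - 3 * P.1) ^+ 2 + (A.2 + B.2 + C.2 - 3 * P.2) ^+ 2).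

Section Cover.
Context {R : realType} (f : R * R -> \bar R).
Hypothesis f_ge0 : forall x, (0 <= f x)%E.
Hypothesis mf : measurable_fun setT f.

(* Passing to a measurable superset makes this monotone in [S], so that covers
   can be by arbitrary sets. *)
Definition mass_le (S : set (R * R)) (c : R) : Prop :=
  exists S' : set (R * R), [/\ measurable S', S `<=` S' &
    (\int[@leb2 R]_(x in S') f x <= c%:E)%E].

Lemma mass_le_sub (S T : set (R * R)) (c c' : R) :
  S `<=` T -> c <= c' -> mass_le T c -> mass_le S c'.
Proof.
move=> ST cc' [S' [mS' TS' le]]; exists S'; split => //; first exact: subset_trans TS'.
by apply: le_trans le _; rewrite lee_fin.
Qed.

(** Only the part of [T'] outside [S'] is added to [S']; since [f] is nonnegative, it costs no more
    than all of [T']. *)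
Lemma mass_leU (S T : set (R * R)) (c c' : R) :
  mass_le S c -> mass_le T c' -> mass_le (S `|` T) (c + c').
Proof.
move=> [S' [mS SS' leS]] [T' [mT TT' leT]].
exists (S' `|` T'); split.
- exact: measurableU.
- exact: setUSS.
have mD : measurable ((S' `|` T') `\` S') by apply: measurableD => //; exact: measurableU.
rewrite -(setDUK (@subsetUl _ S' T')) ge0_integral_setU //; first last.
- by rewrite disj_set2E setDIK.
- exact: measurable_funTS.
rewrite EFinD; apply: leeD => //; apply: le_trans leT.
apply: ge0_subset_integral => //; first exact: measurable_funTS.
by move=> x [[]].
Qed.

Lemma mass_le_set0 : mass_le set0 0.
Proof. by exists set0; split => //; rewrite integral_set0. Qed.

Lemma mass_le_seq (T : eqType) (s : seq T) (S : T -> set (R * R)) (c : R) :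
  (forall t, t \in s -> mass_le (S t) c) ->
  mass_le [set x | exists2 t, t \in s & S t x] ((size s)%:R * c).
Proof.
elim: s => [|t s IH] H.
  by rewrite mul0r; apply: mass_le_sub mass_le_set0 => // x [].
have := mass_leU _ _ _ _ (H t (mem_head _ _))
  (IH (fun u us => H u (@mem_behead _ (t :: s) u us))).
apply: mass_le_sub; last by rewrite /= -[(size s).+1]addn1 natrD; lra.
move=> x [u]; rewrite inE => /orP[/eqP -> Sx|us Sx]; first by left.
by right; exists u.
Qed.

Variable P : R * R.
Hypothesis f_le : forall x, (f x <= (sqdist x P)%:E)%E.

(** Dominating [f] by the squared distance to a single [P] is what assigning a piece to the site [P]
    means; the piece then costs at most its second moment about [P]. *)
Lemma mass_le_trapezoid (y0 y1 l0 l1 r0 r1 : R) : y0 <= y1 ->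
  (forall y, y0 <= y <= y1 -> l0 + l1 * y <= r0 + r1 * y) ->
  let F := slice_moment l0 l1 r0 r1 P in
  mass_le (trapezoid y0 y1 l0 l1 r0 r1)
   ((y1 - y0) / 6 * (F y0 + 4 * F ((y0 + y1) / 2) + F y1)).
Proof.
move=> y01 lr F; exists (trapezoid y0 y1 l0 l1 r0 r1).
have mT := measurable_trapezoid y0 y1 l0 l1 r0 r1.
split => //; rewrite -integral_trapezoid //.
apply: ge0_le_integral => //; apply: measurable_funTS => //.
exact: measurable_sqdist.
Qed.

Lemma moment3_ge0 (A B C : R * R) : 0 <= moment3 P A B C.
Proof. by rewrite /moment3 /sqdist mulr_ge0 ?divr_ge0 ?addr_ge0 ?sqr_ge0. Qed.

(** The segment lies in a trapezoid of height zero, which has no mass. This case is separate because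
    the edges cannot be written with [x] affine in [y]. *)
Lemma mass_le_horizontal (A B C : R * R) : A.2 = B.2 -> C.2 = B.2 ->
  mass_le (conv3 A B C) (moment3 P A B C).
Proof.
move=> AB CB.
pose l := - (`|A.1| + `|B.1| + `|C.1|); pose r := `|A.1| + `|B.1| + `|C.1|.
have lr : l <= r by rewrite ge0_cp // !addr_ge0.
have Q : mass_le (trapezoid B.2 B.2 l 0 r 0) 0.
  have := mass_le_trapezoid B.2 B.2 l 0 r 0 (lexx _).
  by rewrite /= subrr !mul0r; apply => y _; rewrite !mul0r !addr0.
apply: mass_le_sub Q; last exact: moment3_ge0.
  move=> x [a [b [c [a0 b0 c0 abc ->]]]]; rewrite /trapezoid /= AB CB.
  have ble : b <= 1 by lra. 
  have ale : a <= 1 by lra. 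
  have cle : c <= 1 by lra.
  have K (t z : R) : 0 <= t -> t <= 1 -> - `|z| <= t * z <= `|z|.
    move=> t0 t1; rewrite -ler_norml normrM ger0_norm //.
    by rewrite -[X in _ <= X]mul1r ler_wpM2r.
  have /andP[A1 A2] := K a A.1 a0 ale.
  have /andP[B1 B2] := K b B.1 b0 ble.
  have /andP[C1 C2] := K c C.1 c0 cle.
  have E : a * B.2 + b * B.2 + c * B.2 = B.2 by rewrite -!mulrDl abc mul1r.
  by split; rewrite ?E //; rewrite mul0r /l /r; lra.
Qed.

(** A triangle with a horizontal side is a trapezoid whose other base shrinks to the apex [C]; its
    exact integral simplifies to [moment3]. *)
Lemma mass_le_flat_triangle (A B C : R * R) : A.2 = B.2 ->
  mass_le (conv3 A B C) (moment3 P A B C).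
Proof.
move=> AB.
wlog le1 : A B AB / A.1 <= B.1.
  move=> W; have [/(W _ _ AB) //|/ltW/(W _ _ (esym AB))] := leP A.1 B.1.
  apply: mass_le_sub.
    move=> x [a [b [c [a0 b0 c0 abc ->]]]]; exists b, a, c; split => //; first lra.
    by congr pair; ring.
  rewrite /moment3 (_ : det3 B A C = - det3 A B C) ?normrN; last by rewrite /det3 AB;
    ring.
  by rewrite le_eqVlt; apply/predU1l; ring.
have [CB|CB] := eqVneq C.2 B.2; first exact: mass_le_horizontal.
pose h := B.2.
have nz : C.2 - h != 0 by rewrite subr_eq0.
(* The edges [A C] and [B C] as graphs over [y]. *)
pose l1 := (C.1 - A.1) / (C.2 - h); pose r1 := (C.1 - B.1) / (C.2 - h).
pose l0 := A.1 - l1 * h; pose r0 := B.1 - r1 * h.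
have lrE y : r0 + r1 * y - (l0 + l1 * y) = (B.1 - A.1) * ((C.2 - y) / (C.2 - h)).
  by rewrite /r0 /l0 /l1 /r1; field.
have FE : forall y, let t := (C.2 - y) / (C.2 - h) in 
   slice_moment l0 l1 r0 r1 P y =
  ((C.1 + t * (B.1 - C.1) - P.1) ^+ 3 - (C.1 + t * (A.1 - C.1) - P.1) ^+ 3) / 3
  + (B.1 - A.1) * t * (y - P.2) ^+ 2.
  by move=> y; rewrite /slice_moment lrE /r0 /l0 /l1 /r1; field.
(* The weight [c] measures the height above the base, and the horizontal gaps to the left and right
   edges are [b] and [a] times the base length. *)
have inT a b c : 0 <= a -> 0 <= b -> 0 <= c -> a + b + c = 1 ->
   let x := (a * A.1 + b * B.1 + c * C.1, a * A.2 + b * B.2 + c * C.2) in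
   [/\ x.2 = h + c * (C.2 - h), l0 + l1 * x.2 <= x.1 & x.1 <= r0 + r1 * x.2].
  move=> a0 b0 c0 abc /=.
  have aE : a = 1 - b - c by lra.
  have yE : a * A.2 + b * B.2 + c * C.2 = h + c * (C.2 - h).
    by rewrite AB /h aE; ring.
  have d0 : 0 <= B.1 - A.1 by lra.
  split => //; rewrite yE -subr_ge0.
    rewrite [X in 0 <= X](_ : _ = b * (B.1 - A.1)) ?mulr_ge0 //.
    by rewrite /l0 /l1 aE; field.
  rewrite [X in 0 <= X](_ : _ = a * (B.1 - A.1)) ?mulr_ge0 //.
  by rewrite /r0 /r1 aE; field.
have ple y : 0 <= (C.2 - y) / (C.2 - h) -> l0 + l1 * y <= r0 + r1 * y.
  by move=> H; rewrite -subr_ge0 lrE mulr_ge0 //; lra.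
(* The apex may lie above or below the base; only the order of the two heights changes. *)
have [hC|Ch] := leP h C.2.
  have H : forall y, h <= y <= C.2 -> l0 + l1 * y <= r0 + r1 * y.
    by move=> y /andP[? ?]; apply: ple; rewrite divr_ge0 //; lra.
  apply: mass_le_sub (mass_le_trapezoid h C.2 l0 l1 r0 r1 hC H).
  - move=> x [a [b [c [a0 b0 c0 abc ->]]]].
    have [xE H1 H2] := inT a b c a0 b0 c0 abc.
    split => //; rewrite xE; first by rewrite lerDl mulr_ge0 //; lra.
    by rewrite -subr_ge0 (_ : _ - _ = (1 - c) * (C.2 - h)) ?mulr_ge0; try lra; ring.
  - rewrite !FE /moment3 /det3 /sqdist AB -/h.
    rewrite (_ : _ - _ * (h - h) = (B.1 - A.1) * (C.2 - h)); last by ring.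
    rewrite ger0_norm ?mulr_ge0; try lra.
    by rewrite le_eqVlt; apply/predU1l; field.
have H : forall y, C.2 <= y <= h -> l0 + l1 * y <= r0 + r1 * y.
  move=> y /andP[? ?]; apply: ple; rewrite -[_ - y]opprB -[_ - h]opprB invrN mulrNN.
  by rewrite divr_ge0 //; lra.
apply: mass_le_sub (mass_le_trapezoid C.2 h l0 l1 r0 r1 (ltW Ch) H).
- move=> x [a [b [c [a0 b0 c0 abc ->]]]].
  have [xE H1 H2] := inT a b c a0 b0 c0 abc.
  split => //; rewrite xE -subr_ge0.
    by rewrite (_ : _ - _ = (1 - c) * (h - C.2)) ?mulr_ge0; try lra; ring.
  by rewrite (_ : _ - _ = c * (h - C.2)) ?mulr_ge0; try lra; ring.
- rewrite !FE /moment3 /det3 /sqdist AB -/h.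
  rewrite (_ : _ - _ * (h - h) = - ((B.1 - A.1) * (h - C.2))); last by ring.
  rewrite normrN ger0_norm ?mulr_ge0; try lra.
  by rewrite le_eqVlt; apply/predU1l; field.
Qed.

(** The horizontal line through the vertex of middle height cuts the triangle into two with a
    horizontal side. The swaps generate all permutations, which reduces to vertices sorted by
    height. *)
Lemma mass_le_triangle (A B C : R * R) :
  mass_le (conv3 A B C) (moment3 P A B C).
Proof.
have swap12 (A' B' C' : R * R) : mass_le (conv3 A' B' C') (moment3 P A' B' C') ->
    mass_le (conv3 B' A' C') (moment3 P B' A' C').
  apply: mass_le_sub.
    move=> x [a [b [c [a0 b0 c0 abc ->]]]]; exists b, a, c; split => //; first lra.
    by congr pair; ring.
  rewrite /moment3 (_ : det3 B' A' C' = - det3 A' B' C') ?normrN;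
    last by rewrite /det3; ring.
  by rewrite le_eqVlt; apply/predU1l; ring.
have swap23 (A' B' C' : R * R) : mass_le (conv3 A' B' C') (moment3 P A' B' C') ->
    mass_le (conv3 A' C' B') (moment3 P A' C' B').
  apply: mass_le_sub.
    move=> x [a [b [c [a0 b0 c0 abc ->]]]]; exists a, c, b; split => //; first lra.
    by congr pair; ring.
  rewrite /moment3 (_ : det3 A' C' B' = - det3 A' B' C') ?normrN;
    last by rewrite /det3; ring.
  by rewrite le_eqVlt; apply/predU1l; ring.
have sorted (A' B' C' : R * R) : A'.2 <= B'.2 -> B'.2 <= C'.2 ->
    mass_le (conv3 A' B' C') (moment3 P A' B' C').
  move: A' B' C' => {A B C} A B C.
  rewrite le_eqVlt => /orP[/eqP AB _|AB]; first exact: mass_le_flat_triangle.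
  rewrite le_eqVlt => /orP[/eqP BC|BC].
    by apply/swap12/swap23/mass_le_flat_triangle.
  pose t := (B.2 - A.2) / (C.2 - A.2).
  have nz : C.2 - A.2 != 0 by rewrite gt_eqF //; lra.
  have t0 : 0 < t by rewrite divr_gt0 //; lra.
  have t1 : 0 < 1 - t.
    rewrite (_ : 1 - t = (C.2 - B.2) / (C.2 - A.2)); first by rewrite divr_gt0 //; lra.
    by rewrite /t; field.
  have B2 : B.2 = A.2 + t * (C.2 - A.2) by rewrite /t; field.
  (* The point of [A C] at the height of [B]. *)
  pose D := (A.1 + t * (C.1 - A.1), B.2).
  have DB : D.2 = B.2 by [].
  have QA := mass_le_flat_triangle D B A DB.
  have QC := mass_le_flat_triangle D B C DB.
  apply: mass_le_sub (mass_leU _ _ _ _ QA QC).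
    move=> x [a [b [c [a0 b0 c0 abc xE]]]].
    (* As [D = (1 - t) A + t C], the part of the point along [A C] can trade all of its [C] for [D]
       when enough [A] is available, and otherwise all of its [A]. *)
    have [H|H] := leP (c * (1 - t)) (a * t).
      left; exists (c / t), b, (a - c * (1 - t) / t); split => //.
      - by rewrite divr_ge0 // ltW.
      - by rewrite subr_ge0 ler_pdivrMr.
      - by rewrite -[RHS]abc; field; rewrite gt_eqF.
      - by rewrite xE /= B2; congr pair; field; rewrite gt_eqF.
    right; exists (a / (1 - t)), b, (c - a * t / (1 - t)); split => //.
    - by rewrite divr_ge0 // ltW.
    - by rewrite subr_ge0 ler_pdivrMr // ltW.
    - by rewrite -[RHS]abc; field; rewrite gt_eqF.
    - by rewrite xE /= B2; congr pair; field; rewrite gt_eqF.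
  rewrite /moment3.
  rewrite (_ : det3 D B A = - t * det3 A B C); last by rewrite /det3 /= B2; ring.
  rewrite (_ : det3 D B C = (1 - t) * det3 A B C); last by rewrite /det3 /= B2; ring.
  rewrite !normrM normrN (gtr0_norm t0) (gtr0_norm t1) /sqdist /= B2.
  by rewrite le_eqVlt; apply/predU1l; field.
have [AB|/ltW BA] := leP A.2 B.2; have [BC|/ltW CB] := leP B.2 C.2;
  have [AC|/ltW CA] := leP A.2 C.2.
- exact: sorted.
- exact: sorted.
- by apply/swap23/sorted.
- by apply/swap23/swap12/sorted.
- by apply/swap12/sorted.
- by apply/swap12/swap23/sorted.
- by apply/swap12/swap23/swap12/sorted => //; apply: le_trans AC.
- by apply/swap12/swap23/swap12/sorted.
Qed.

End Cover.

(** * Affine coordinates and the indexing of lattice cells *)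

Definition lin2 {R : realType} (V t n : R * R) (a b : R) : R * R :=
  (V.1 + a * t.1 + b * n.1, V.2 + a * t.2 + b * n.2).

Definition dot {R : realType} (t n : R * R) : R := t.1 * n.1 + t.2 * n.2.

Definition cross {R : realType} (t n : R * R) : R := t.1 * n.2 - n.1 * t.2.

Lemma det3_lin2 {R : realType} (V t n : R * R) (a b a' b' a'' b'' : R) :
  det3 (lin2 V t n a b) (lin2 V t n a' b') (lin2 V t n a'' b'') =
  ((a' - a) * (b'' - b) - (a'' - a) * (b' - b)) * cross t n.
Proof. by rewrite /det3 /lin2 /cross /=; ring. Qed.

(** With the site [P] itself as a vertex, only the Gram entries and the area of the axes remain; the
    boundary pieces are all cut into such triangles. *)
Lemma moment3_lin2 {R : realType} (P t n : R * R) (a b a' b' : R) :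
  moment3 P P (lin2 P t n a b) (lin2 P t n a' b') =
  `|(a * b' - a' * b) * cross t n| / 12 *
  ((a ^+ 2 + a' ^+ 2 + a * a') * dot t t + (b ^+ 2 + b' ^+ 2 + b * b') * dot n n
   + (2 * a * b + 2 * a' * b' + a * b' + a' * b) * dot t n).
Proof.
rewrite /moment3 (_ : det3 _ _ _ = (a * b' - a' * b) * cross t n); last first.
  by rewrite /det3 /lin2 /cross /=; ring.
by rewrite /sqdist /lin2 /dot /=; field.
Qed.

Definition tri_idx (n : nat) : seq (nat * nat) :=
  [seq (i, j) | i <- iota 0 n, j <- iota 0 (n - i)].

Lemma mem_tri_idx (n i j : nat) : ((i, j) \in tri_idx n) = (i + j < n)%N.
Proof.
apply/idP/idP => [/allpairsPdep[i' [j' [+ + [-> ->]]]]|H].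
  by rewrite !mem_iota; lia.
apply/allpairsPdep; exists i, j; rewrite !mem_iota; split => //; lia.
Qed.

Lemma size_tri_idx (n : nat) : (2 * size (tri_idx n) = n * n.+1)%N.
Proof.
rewrite size_allpairs_dep.
under eq_map do rewrite size_iota.
elim: n => // n IH.
rewrite (_ : [seq _ | _ <- iota 0 n.+1] = n.+1 :: [seq (n - x)%N | x <- iota 0 n]);
  last first.
  by rewrite /= -[1%N]addn0 iotaDl -map_comp; congr cons; apply: eq_map => i /=; lia.
by rewrite /= mulnDr IH; lia.
Qed.

(** An integer part kept below [m]: the intervals are closed, so [a = m] falls in the last one. *)
Lemma natr_interval {R : realType} (m : nat) (a : R) : (0 < m)%N -> 0 <= a <= m%:R ->
  exists2 i : nat, (i < m)%N & i%:R <= a <= i%:R + 1.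
Proof.
elim: m a => // m IH a _ /andP[a0 am].
have [a1|a1] := leP a 1; first by exists 0%N => //; rewrite a0 add0r.
case: m IH am => [|m] IH am; first lra.
have [||i im /andP[H1 H2]] := IH (a - 1) => //.
  by rewrite subr_ge0 ltW //= lerBlDr (le_trans am) // -[m.+2]addn1 natrD.
by exists i.+1 => //; rewrite -[i.+1]addn1 natrD; apply/andP; split; lra.
Qed.

(* In affine coordinates, the unit cells are the triangles
   (i,j), (i+1,j), (i,j+1) and (i+1,j), (i,j+1), (i+1,j+1). *)
Lemma triangular_cell {R : realType} (m : nat) (a b : R) : (0 < m)%N ->
  0 <= a -> 0 <= b -> a + b <= m%:R ->
  exists i j : nat, [/\ i%:R <= a, j%:R <= b &
    ((i + j < m)%N /\ a + b <= i%:R + j%:R + 1) \/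
    [/\ (i + j < m.-1)%N, i%:R + j%:R + 1 <= a + b, a <= i%:R + 1 & b <= j%:R + 1]].
Proof.
elim: m a b => // m IH a b _ a0 b0 abm.
have [ab1|ab1] := leP (a + b) 1.
  by exists 0%N, 0%N; split => //; left; rewrite !add0r.
(* Since [a + b > 1], the triangle has size at least two, which is what the inverted cell at the
   origin needs below. *)
case: m IH abm => [|m] IH abm; first lra.
have abm' : a + b <= m.+1%:R + 1 by rewrite natr1.
(* Lowering by one a coordinate that is at least one reduces to a triangle of size smaller by
   one. *)
have [a1|a1] := leP 1 a.
  have [||||i [j [H1 H2 H3]]] := IH (a - 1) b => //; try lra.
  exists i.+1, j; rewrite -[i.+1]addn1 natrD; split => //; first lra.
  case: H3 => [[H3 H4]|[H3 H4 H5 H6]]; [left|right]; split => //; try lra; lia.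
have [b1|b1] := leP 1 b.
  have [||||i [j [H1 H2 H3]]] := IH a (b - 1) => //; try lra.
  exists i, j.+1; rewrite -[j.+1]addn1 natrD; split => //; first lra.
  case: H3 => [[H3 H4]|[H3 H4 H5 H6]]; [left|right]; split => //; try lra; lia.
by exists 0%N, 0%N; split => //; right; split; rewrite ?add0r //; lra.
Qed.

(** * Costs of the equilateral cells and of the boundary strips *)

Section Pieces.
Context {R : realType} (f : R * R -> \bar R).
Hypothesis f_ge0 : forall x, (0 <= f x)%E.
Hypothesis mf : measurable_fun setT f.

Let site (P : R * R) : Prop := forall x, (f x <= (sqdist x P)%:E)%E.
Let Q := mass_le f.

(** One piece of the barycentric subdivision, assigned to its vertex [A]: its area is a sixth of the
    whole and its moment a multiple of the squared side. *)
Lemma mass_le_sixth (A B C M G : R * R) (d2 : R) : site A ->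
  sqdist A B = d2 -> sqdist B C = d2 -> sqdist A C = d2 ->
  M = ((A.1 + B.1) / 2, (A.2 + B.2) / 2) ->
  G = ((A.1 + B.1 + C.1) / 3, (A.2 + B.2 + C.2) / 3) ->
  Q (conv3 A M G) (5 / 432 * `|det3 A B C| * d2).
Proof.
move=> sA AB BC AC ME GE.
apply: mass_le_sub (mass_le_triangle f f_ge0 mf A sA A M G) => //.
rewrite /moment3 (_ : det3 A M G = det3 A B C / 6); last first.
  by rewrite /det3 ME GE /=; field.
rewrite normrM (ger0_norm (_ : 0 <= 6^-1)) //.
have -> : sqdist A A + sqdist M A + sqdist G A + (A.1 + M.1 + G.1 - 3 * A.1) ^+ 2 +
   (A.2 + M.2 + G.2 - 3 * A.2) ^+ 2 = 5 / 3 * d2.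
  (* Without equal sides the sum is [13/9], [11/18] and [-7/18] times the squared lengths of [A B],
     [A C] and [B C]; these coefficients add up to [5/3]. *)
  rewrite [RHS](_ : _ = 5 / 3 * d2 + 13 / 9 * (sqdist A B - d2) +
    11 / 18 * (sqdist A C - d2) - 7 / 18 * (sqdist B C - d2)); last first.
    by rewrite AB BC AC; ring.
  by rewrite ME GE /sqdist /=; field.
by rewrite le_eqVlt; apply/predU1l; field.
Qed.

(** Each vertex takes the two sixths of the barycentric subdivision touching it, its Voronoi share.
    The order of the barycentric weights of a point tells which sixth contains it. *)
Lemma mass_le_equilateral (A B C : R * R) (d2 : R) :
  site A -> site B -> site C ->
  sqdist A B = d2 -> sqdist B C = d2 -> sqdist A C = d2 ->
  Q (conv3 A B C) (5 / 72 * `|det3 A B C| * d2).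
Proof.
move=> sA sB sC AB BC AC.
have sym (X Y : R * R) : sqdist X Y = sqdist Y X by rewrite /sqdist; ring.
pose mid (X Y : R * R) := ((X.1 + Y.1) / 2, (X.2 + Y.2) / 2).
pose G := ((A.1 + B.1 + C.1) / 3, (A.2 + B.2 + C.2) / 3).
have midC X Y : mid X Y = mid Y X by rewrite /mid addrC [X.2 + _]addrC.
have D1 : `|det3 A C B| = `|det3 A B C| by rewrite -normrN; congr `|_|; rewrite /det3;
  ring.
have D2 : `|det3 B A C| = `|det3 A B C| by rewrite -normrN; congr `|_|; rewrite /det3;
  ring.
have D3 : `|det3 B C A| = `|det3 A B C| by congr `|_|; rewrite /det3; ring.
have D4 : `|det3 C A B| = `|det3 A B C| by congr `|_|; rewrite /det3; ring.
have D5 : `|det3 C B A| = `|det3 A B C| by rewrite -normrN; congr `|_|; rewrite /det3;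
  ring.
have Q1 : Q (conv3 A (mid A B) G) (5 / 432 * `|det3 A B C| * d2).
  exact: (@mass_le_sixth A B C).
have Q2 : Q (conv3 A (mid A C) G) (5 / 432 * `|det3 A B C| * d2).
  by rewrite -D1; apply: mass_le_sixth; rewrite // 1?sym // /G; congr pair;
    congr (_ / _); ring.
have Q3 : Q (conv3 B (mid A B) G) (5 / 432 * `|det3 A B C| * d2).
  by rewrite midC -D2; apply: mass_le_sixth; rewrite // 1?sym // /G; congr pair;
    congr (_ / _); ring.
have Q4 : Q (conv3 B (mid B C) G) (5 / 432 * `|det3 A B C| * d2).
  by rewrite -D3; apply: mass_le_sixth; rewrite // 1?sym // /G; congr pair;
    congr (_ / _); ring.
have Q5 : Q (conv3 C (mid A C) G) (5 / 432 * `|det3 A B C| * d2).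
  by rewrite midC -D4; apply: mass_le_sixth; rewrite // 1?sym // /G; congr pair;
    congr (_ / _); ring.
have Q6 : Q (conv3 C (mid B C) G) (5 / 432 * `|det3 A B C| * d2).
  by rewrite midC -D5; apply: mass_le_sixth; rewrite // 1?sym // /G; congr pair;
    congr (_ / _); ring.
have U := mass_leU f f_ge0 mf.
have H := U _ _ _ _ (U _ _ _ _ (U _ _ _ _ Q1 Q2) (U _ _ _ _ Q3 Q4)) (U _ _ _ _ Q5 Q6).
apply: mass_le_sub H; last by rewrite le_eqVlt; apply/predU1l; field.
(* For a >= b >= c: aA + bB + cC = (a-b)A + 2(b-c)(A+B)/2 + 3c G. *)
have K (X Y Z : R * R) (x y z : R) : 0 <= z -> z <= y -> y <= x -> x + y + z = 1 ->
   G = ((X.1 + Y.1 + Z.1) / 3, (X.2 + Y.2 + Z.2) / 3) ->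
   conv3 X (mid X Y) G (x * X.1 + y * Y.1 + z * Z.1, x * X.2 + y * Y.2 + z * Z.2).
  move=> z0 zy yx xyz GE; exists (x - y), (2 * (y - z)), (3 * z); split;
    [lra|lra|lra|lra|].
  by rewrite GE /=; congr pair; field.
move=> p [a [b [c [a0 b0 c0 abc ->]]]].
have [ab|/ltW ab] := leP a b; have [bc|/ltW bc] := leP b c; have [ac|/ltW ac] := leP a c.
- right; right; rewrite midC [X in conv3 _ _ _ X](_ : _ = (c * C.1 + b * B.1 +
  a * A.1, c * C.2 + b * B.2 + a * A.2)); last by congr pair; ring.
  by apply: K => //; [lra|rewrite /G; congr pair; congr (_ / _); ring].
- right; right; rewrite midC [X in conv3 _ _ _ X](_ : _ = (c * C.1 + b * B.1 +
  a * A.1, c * C.2 + b * B.2 + a * A.2)); last by congr pair; ring.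
  by apply: K => //; [lra|rewrite /G; congr pair; congr (_ / _); ring].
- left; right; right; rewrite [X in conv3 _ _ _ X](_ : _ = (b * B.1 + c * C.1 +
  a * A.1, b * B.2 + c * C.2 + a * A.2)); last by congr pair; ring.
  by apply: K => //; [lra|rewrite /G; congr pair; congr (_ / _); ring].
- left; right; left; rewrite midC [X in conv3 _ _ _ X](_ : _ = (b * B.1 + a * A.1 +
  c * C.1, b * B.2 + a * A.2 + c * C.2)); last by congr pair; ring.
  by apply: K => //; [lra|rewrite /G; congr pair; congr (_ / _); ring].
- right; left; rewrite midC [X in conv3 _ _ _ X](_ : _ = (c * C.1 + a * A.1 +
  b * B.1, c * C.2 + a * A.2 + b * B.2)); last by congr pair; ring.
  by apply: K => //; [lra|rewrite /G; congr pair; congr (_ / _); ring].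
- left; left; right; rewrite [X in conv3 _ _ _ X](_ : _ = (a * A.1 + c * C.1 +
  b * B.1, a * A.2 + c * C.2 + b * B.2)); last by congr pair; ring.
  by apply: K => //; [lra|rewrite /G; congr pair; congr (_ / _); ring].
- left; left; left; apply: K => //; lra.
- by left; left; left; apply: K.
Qed.

(** The conditions on [t] and [n] make them two sides of an equilateral triangle, so all cells are
    equilateral. There are [m (m + 1) / 2] upright and [m (m - 1) / 2] inverted ones, [m ^ 2] in
    all. *)
Lemma mass_le_lattice_triangle (m : nat) (V t n : R * R) : (0 < m)%N ->
  dot n n = dot t t -> 2 * dot t n = dot t t ->
  (forall i j : nat, (i + j <= m)%N -> site (lin2 V t n i%:R j%:R)) ->
  Q [set x | exists a b : R, [/\ 0 <= a, 0 <= b, a + b <= m%:R & x = lin2 V t n a b]]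
    (m%:R ^+ 2 * (5 / 72 * `|cross t n| * dot t t)).
Proof.
move=> m0 nn tn sites.
pose up (i j : nat) := conv3 (lin2 V t n i%:R j%:R) (lin2 V t n i.+1%:R j%:R)
  (lin2 V t n i%:R j.+1%:R).
(* Starting from the far corner keeps the orientation of [up], so that both determinants are
   [cross t n]. *)
pose dn (i j : nat) := conv3 (lin2 V t n i.+1%:R j.+1%:R) (lin2 V t n i%:R j.+1%:R)
  (lin2 V t n i.+1%:R j%:R).
pose c := 5 / 72 * `|cross t n| * dot t t.
(* In lattice coordinates the squared length is the form [p ^ 2 + p q + q ^ 2] times [dot t t]. *)
have dist (a b a' b' : R) : (a - a') ^+ 2 + (b - b') ^+ 2 + (a - a') * (b - b') = 1 ->
    sqdist (lin2 V t n a b) (lin2 V t n a' b') = dot t t.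
  move=> H; rewrite [LHS](_ : _ = (a - a') ^+ 2 * dot t t + (b - b') ^+ 2 * dot n n
     + (a - a') * (b - b') * (2 * dot t n)).
    by rewrite nn tn -!mulrDl H mul1r.
  by rewrite /sqdist /dot /=; ring.
have Qup (i j : nat) : (i + j < m)%N -> Q (up i j) c.
  move=> ij; have := @mass_le_equilateral (lin2 V t n i%:R j%:R) (lin2 V t n i.+1%:R j%:R)
    (lin2 V t n i%:R j.+1%:R) (dot t t).
  rewrite det3_lin2 -[i.+1]addn1 -[j.+1]addn1 !natrD (_ : _ - _ = 1); last by ring.
  rewrite mul1r /up -[i.+1]addn1 -[j.+1]addn1 !natrD; apply.
  - by apply: sites; lia.
  - by rewrite -natrD; apply: sites; lia.
  - by rewrite -natrD; apply: sites; lia.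
  - by apply: dist; ring.
  - by apply: dist; ring.
  - by apply: dist; ring.
have Qdn (i j : nat) : (i + j < m.-1)%N -> Q (dn i j) c.
  move=> ij; have := @mass_le_equilateral (lin2 V t n i.+1%:R j.+1%:R)
    (lin2 V t n i%:R j.+1%:R)
    (lin2 V t n i.+1%:R j%:R) (dot t t).
  rewrite det3_lin2 -[i.+1]addn1 -[j.+1]addn1 !natrD (_ : _ - _ = 1); last by ring.
  rewrite mul1r /dn -[i.+1]addn1 -[j.+1]addn1 !natrD; apply.
  - by rewrite -!natrD; apply: sites; lia.
  - by rewrite -natrD; apply: sites; lia.
  - by rewrite -natrD; apply: sites; lia.
  - by apply: dist; ring.
  - by apply: dist; ring.
  - by apply: dist; ring.
have QU : Q [set x | exists2 ij, ij \in tri_idx m & up ij.1 ij.2 x] ((size (tri_idx m))%:R * c).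
  by apply: mass_le_seq => // -[i j]; rewrite mem_tri_idx; exact: Qup.
have QD : Q [set x | exists2 ij, ij \in tri_idx m.-1 & dn ij.1 ij.2 x] ((size (tri_idx m.-1))%:R * c).
  by apply: mass_le_seq => // -[i j]; rewrite mem_tri_idx; exact: Qdn.
apply: mass_le_sub (mass_leU f f_ge0 mf _ _ _ _ QU QD).
  move=> x [a [b [a0 b0 abm ->]]].
  have [i [j [ia jb H]]] := triangular_cell m a b m0 a0 b0 abm.
  case: H => [[ij H]|[ij H ai bj]].
    left; exists (i, j); first by rewrite mem_tri_idx.
    exists (i%:R + j%:R + 1 - a - b), (a - i%:R), (b - j%:R); split; [lra|lra|lra|lra|].
    by rewrite /= -[i.+1]addn1 -[j.+1]addn1 !natrD /lin2; congr pair; ring.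
  right; exists (i, j); first by rewrite mem_tri_idx.
  exists (a + b - i%:R - j%:R - 1), (i%:R + 1 - a), (j%:R + 1 - b); split;
    [lra|lra|lra|lra|].
  by rewrite /= -[i.+1]addn1 -[j.+1]addn1 !natrD /lin2; congr pair; ring.
rewrite -mulrDl -natrD (_ : (_ + _)%N = (m ^ 2)%N) ?natrX //.
have := size_tri_idx m; have := size_tri_idx m.-1.
case: m m0 {sites Qup Qdn QU QD} => // m _ /=; nia.
Qed.

(** The rectangle is cut along the diagonal from its corner [P]. A negative [v] places it on the
    other side of the site. *)
Lemma mass_le_rect (P t n : R * R) (v : R) : site P -> dot t n = 0 ->
  Q [set x | exists a b : R, [/\ 0 <= a <= 1, 0 <= b <= 1 & x = lin2 P t n (a * v) b]]
    (`|v * cross t n| / 3 * (v ^+ 2 * dot t t + dot n n)).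
Proof.
move=> sP tn.
have T1 := mass_le_triangle f f_ge0 mf P sP P (lin2 P t n v 0) (lin2 P t n v 1).
have T2 := mass_le_triangle f f_ge0 mf P sP P (lin2 P t n 0 1) (lin2 P t n v 1).
apply: mass_le_sub (mass_leU f f_ge0 mf _ _ _ _ T1 T2).
  move=> x [a [b [/andP[a0 a1] /andP[b0 b1] ->]]].
  have [ab|/ltW ab] := leP a b; [right|left].
    exists (1 - b), (b - a), a; split; [lra|lra|lra|lra|].
    by rewrite /lin2 /=; congr pair; ring.
  exists (1 - a), (a - b), b; split; [lra|lra|lra|lra|].
  by rewrite /lin2 /=; congr pair; ring.
rewrite !moment3_lin2 tn (_ : v * 1 - v * 0 = v); last by ring.
rewrite (_ : 0 * 1 - v * 1 = - v); last by ring.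
by rewrite mulNr normrN le_eqVlt; apply/orP; left; apply/eqP; field.
Qed.

(** A strip along a row of sites, widening away from it. Each unit rectangle is halved between its
    two sites; what sticks out beyond the first and last site is a right triangle with legs [n] and
    [k t]. *)
Lemma mass_le_side (m : nat) (V t n : R * R) (k : R) : (0 < m)%N -> 0 < k ->
  dot t n = 0 ->
  (forall i : nat, (i <= m)%N -> site (lin2 V t n i%:R 0)) ->
  Q [set x | exists a b : R, [/\ 0 <= b <= 1, - k * b <= a, a <= m%:R + k * b &
                               x = lin2 V t n a b]]
    (m%:R * (`|cross t n| / 3 * (dot t t / 4 + dot n n)) +
     k * `|cross t n| / 6 * (3 * dot n n + k ^+ 2 * dot t t)).
Proof.
move=> m0 k0 tn sites.
pose V' (i : nat) := lin2 V t n i%:R 0.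
pose c := `|cross t n| / 3 * (dot t t / 4 + dot n n).
pose rect (i : nat) : set (R * R) :=
  [set x | exists a b : R, [/\ i%:R <= a <= i%:R + 1, 0 <= b <= 1 & x = lin2 V t n a b]].
have Qrect i : i \in iota 0 m -> Q (rect i) c.
  rewrite mem_iota /= add0n => im.
  have H1 := mass_le_rect (V' i) t n (1 / 2) (sites i (ltnW im)) tn.
  have H2 := mass_le_rect (V' i.+1) t n (- (1 / 2)) (sites i.+1 im) tn.
  apply: mass_le_sub (mass_leU f f_ge0 mf _ _ _ _ H1 H2).
    move=> x [a [b [/andP[ia ai] b01 ->]]].
    have [h|/ltW h] := leP a (i%:R + 1 / 2); [left|right].
      exists (2 * (a - i%:R)), b; split => //; first by apply/andP; split; lra.
      by rewrite /V' /lin2 /=; congr pair; field.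
    exists (2 * (i%:R + 1 - a)), b; split => //; first by apply/andP; split; lra.
    by rewrite /V' -[i.+1]addn1 natrD /lin2 /=; congr pair; field.
  rewrite mulNr normrN normrM ger0_norm; last lra.
  by rewrite /c le_eqVlt; apply/predU1l; field.
have QR := mass_le_seq f f_ge0 mf _ _ _ _ Qrect.
rewrite size_iota in QR.
have T1 := mass_le_triangle f f_ge0 mf (V' 0%N) (sites 0%N (leq0n _)) (V' 0%N)
  (lin2 (V' 0%N) t n 0 1) (lin2 (V' 0%N) t n (- k) 1).
have T2 := mass_le_triangle f f_ge0 mf (V' m) (sites m (leqnn _)) (V' m)
  (lin2 (V' m) t n 0 1) (lin2 (V' m) t n k 1).
have U := mass_leU f f_ge0 mf.
apply: mass_le_sub (U _ _ _ _ QR (U _ _ _ _ T1 T2)).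
  move=> x [a [b [/andP[b0 b1] ka am ->]]].
  have [a0|a0] := leP 0 a; last first.
    right; left; exists (1 - b), (b - - a / k), (- a / k); split; [lra| | |lra|].
    - by rewrite subr_ge0 ler_pdivrMr //; lra.
    - by rewrite divr_ge0 //; lra.
    - by rewrite /V' /lin2 /=; congr pair; field; rewrite gt_eqF.
  have [aM|aM] := leP a m%:R; last first.
    right; right; exists (1 - b), (b - (a - m%:R) / k), ((a - m%:R) / k); split;
      [lra| | |lra|].
    - by rewrite subr_ge0 ler_pdivrMr //; lra.
    - by rewrite divr_ge0 //; lra.
    - by rewrite /V' /lin2 /=; congr pair; field; rewrite gt_eqF.
  left.
  have [i im H] := natr_interval m a m0 (introT andP (conj a0 aM)).
  exists i; first by rewrite mem_iota.
  by exists a, b; split => //; apply/andP.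
rewrite !moment3_lin2 tn (_ : 0 * 1 - k * 1 = - k); last by ring.
rewrite (_ : 0 * 1 - - k * 1 = k); last by ring.
rewrite !normrM normrN (gtr0_norm k0).
by rewrite /c le_eqVlt; apply/predU1l; field.
Qed.

End Pieces.

(** * From mass bounds to the distortion *)

Section Mindist.
Context {R : realType} (alpha : seq (R * R)).

Lemma mindist_ge0 x : (0 <= mindist alpha x)%E.
Proof.
rewrite /mindist; elim: alpha => [|a s IH]; first by rewrite big_nil.
by rewrite big_cons le_min IH andbT lee_fin addr_ge0 ?sqr_ge0.
Qed.

Lemma mindist_le P x : P \in alpha -> (mindist alpha x <= (sqdist x P)%:E)%E.
Proof.
rewrite /mindist; elim: alpha => // a s IH;
  rewrite big_cons inE ge_min => /orP[/eqP->|/IH ->].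
  by rewrite lexx.
by rewrite orbT.
Qed.

Lemma measurable_mindist : measurable_fun setT (mindist alpha).
Proof.
rewrite /mindist; elim: alpha => [|a s IH].
  by under eq_fun do rewrite big_nil; exact: measurable_cst.
under eq_fun do rewrite big_cons.
by apply: measurable_mine => //; exact: measurable_sqdist.
Qed.

End Mindist.

Lemma measurable_triangle {R : realType} : measurable (@triangle R).
Proof.
rewrite (_ : triangle (R:=R) = [set x | 0 * x.1 + -1 * x.2 <= 0]
   `&` [set x | - Num.sqrt 3 * x.1 + 1 * x.2 <= 0]
  `&` [set x | Num.sqrt 3 * x.1 + 1 * x.2 <= Num.sqrt 3]).
  by repeat apply: measurableI; exact: measurable_le_aff.
apply/seteqP; split => -[x y] /=; rewrite /triangle /=.
  by move=> [? [? ?]]; repeat split; lra.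
by move=> [[]] *; repeat split; lra.
Qed.

(** The density is constant on the triangle and zero outside, so it leaves the integral as a
    factor. *)
Lemma distortion_le {R : realType} (alpha : seq (R * R)) (c : R) :
  mass_le (mindist alpha) (@triangle R) c ->
  (distortion alpha <= (4 / Num.sqrt 3 * c)%:E)%E.
Proof.
move=> [S [mS TS le]].
have k0 : 0 <= 4 / Num.sqrt 3 :> R by rewrite divr_ge0 ?sqrtr_ge0.
rewrite /distortion.
under eq_integral => x _.
  rewrite (_ : _ * _ = (4 / Num.sqrt 3)%:E * ((mindist alpha) \_ (@triangle R)) x)%E;
    last first.
    rewrite /tri_density patchE; case: asboolP => H.
      by rewrite mem_set.
    by rewrite memNset // mul0e mule0.
  over.
have mT := @measurable_triangle R.
have mm := measurable_mindist alpha.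
rewrite ge0_integralZl_EFin //; last 2 first.
- by move=> x _; apply: erestrict_ge0 => y _; exact: mindist_ge0.
- by apply/(measurable_restrictT _ _).1 => //; exact: measurable_funTS.
rewrite [leRHS]EFinM; apply: lee_wpmul2l; first by rewrite lee_fin.
rewrite -integral_mkcond; apply: le_trans le.
apply: ge0_subset_integral => //; first exact: measurable_funTS.
by move=> x _; exact: mindist_ge0.
Qed.

(** * The lattice of sites and the cover of the triangle *)

Section Lattice.
Context {R : realType} (N : nat) (d e : R).
Let s : R := Num.sqrt 3.
Let m := N.-1.
Hypothesis N3 : (3 <= N)%N.
Hypothesis d0 : 0 < d.
Hypothesis e0 : 0 < e.
Hypothesis mde : m%:R * d + 2 * s * e = 1.

Let V : R * R := (s * e, e).
Let t1 : R * R := (d, 0).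
Let t2 : R * R := (d / 2, d * s / 2).

(** The corner [V] has distance [e] from the two sides through the origin; [mde] puts the other two
    corners at distance [e] from their sides as well. *)
Definition sites : seq (R * R) :=
  [seq lin2 V t1 t2 ij.1%:R ij.2%:R | ij <- tri_idx N].

Lemma size_sites : size sites = (N * N.+1 %/ 2)%N.
Proof. by rewrite size_map -size_tri_idx mulKn. Qed.

Lemma mindist_sites (i j : nat) (P x : R * R) : (i + j <= m)%N ->
  P = lin2 V t1 t2 i%:R j%:R -> (mindist sites x <= (sqdist x P)%:E)%E.
Proof.
move=> ij ->; apply: mindist_le; apply/mapP; exists (i, j) => //.
by rewrite mem_tri_idx; move: ij; rewrite /m; lia.
Qed.

Let s0 : 0 < s. Proof. by rewrite sqrtr_gt0. Qed.
Let s2 : s * s = 3. Proof. by rewrite -expr2 sqr_sqrtr. Qed.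
Let m0 : (0 < m)%N. Proof. by rewrite /m; lia. Qed.
Let mE : m%:R = (1 - 2 * s * e) / d.
Proof. by rewrite (_ : 1 - _ = m%:R * d); [rewrite mulfK // gt_eqF | move: mde; lra]. Qed.

Let Q := mass_le (mindist sites).
Let side_cost : R := m%:R * (d * e / 3 * (d ^+ 2 / 4 + e ^+ 2)) + s * (e ^+ 2) ^+ 2.

(** Here [a] and [b] are lengths along and across the strip. It ends on the angle bisectors,
    inclined by [pi / 6] to the side, so it widens by [s * b] at either end; in units of [d] and [e]
    this is [k = s * e / d]. *)
Lemma mass_le_triangle_side (W t n : R * R) :
  dot t t = d ^+ 2 -> dot n n = e ^+ 2 -> dot t n = 0 -> `|cross t n| = d * e ->
  (forall i : nat, (i <= m)%N -> exists j k : nat, (j + k <= m)%N /\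
     lin2 W t n i%:R 0 = lin2 V t1 t2 j%:R k%:R) ->
  Q [set x | exists a b : R, [/\ 0 <= b <= e, - s * b <= a, a <= 1 - 2 * s * e + s * b &
                               x = lin2 W t n (a / d) (b / e)]] side_cost.
Proof.
move=> tt nn tn c H.
have k0 : 0 < s * e / d by rewrite divr_gt0 // mulr_gt0.
have dn0 : d != 0 by rewrite gt_eqF.
have en0 : e != 0 by rewrite gt_eqF.
have Hs (i : nat) : (i <= m)%N ->
    forall x, (mindist sites x <= (sqdist x (lin2 W t n i%:R 0))%:E)%E.
  by move=> /H[j [k [jk E]]] x; apply: (mindist_sites j k).
have := mass_le_side (mindist sites) (mindist_ge0 _) (measurable_mindist _)
   m W t n (s * e / d) m0 k0 tn Hs.
apply: mass_le_sub.
  move=> x [a [b [/andP[b0 be] sa as_ ->]]]; exists (a / d), (b / e); split => //.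
  - by rewrite (divr_ge0 b0 (ltW e0)) ler_pdivrMr // mul1r.
  - by rewrite ler_pdivlMr // (_ : _ * d = - s * b) //; field; rewrite ?dn0 ?en0.
  - by rewrite mE ler_pdivrMr // (_ : _ * d = 1 - 2 * s * e + s * b) //; field;
    rewrite ?dn0 ?en0.
rewrite tt nn c.
rewrite (_ : (s * e / d) ^+ 2 * d ^+ 2 = 3 * e ^+ 2); last first.
  by rewrite -s2; field.
rewrite /side_cost lerD2l (_ : s * e / d * (d * e) = s * e ^+ 2); last by field.
by rewrite le_eqVlt; apply/predU1l; field.
Qed.

(** A point at distance at least [e] from all sides lies in the inner triangle; any other one lies
    in the strip of its nearest side. *)
Lemma mass_le_big_triangle :
  Q (@triangle R) (m%:R ^+ 2 * (5 * s / 144 * d ^+ 4) + 3 * side_cost).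
Proof.
have Q0 : Q [set x | exists a b : R, [/\ 0 <= a, 0 <= b, a + b <= m%:R & x =
  lin2 V t1 t2 a b]]
    (m%:R ^+ 2 * (5 * s / 144 * d ^+ 4)).
  have := mass_le_lattice_triangle (mindist sites) (mindist_ge0 _) (measurable_mindist _)
   m V t1 t2 m0.
  have tt : dot t1 t1 = d ^+ 2 by rewrite /dot /=; ring.
  have nn : dot t2 t2 = d ^+ 2.
    rewrite (_ : dot _ _ = d ^+ 2 * (1 + s * s) / 4); last by rewrite /dot /=; field.
    by rewrite s2; field.
  have tn : 2 * dot t1 t2 = d ^+ 2 by rewrite /dot /=; field.
  have -> : `|cross t1 t2| = d ^+ 2 * s / 2.
    rewrite (_ : cross _ _ = d ^+ 2 * s / 2); last by rewrite /cross /=; field.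
    by rewrite ger0_norm // divr_ge0 // mulr_ge0 ?sqr_ge0 // ltW.
  rewrite nn tn tt => H; apply: mass_le_sub (H _ _ _) => //.
    by rewrite le_eqVlt; apply/predU1l; field.
  by move=> i j ij x; apply: (mindist_sites i j).
have de0 : 0 <= d * e by rewrite mulr_ge0 // ltW.
have mdE : m%:R * d = 1 - 2 * s * e by move: mde; lra.
(* The strips of the bottom, right and left sides, each starting at a corner of the inner triangle,
   with [n] pointing outwards. *)
have Q1 : Q [set x | exists a b : R, [/\ 0 <= b <= e, - s * b <= a, a <= 1 - 2 * s * e + s * b &
    x = lin2 (s * e, e) (d, 0) (0, - e) (a / d) (b / e)]] side_cost.
  apply: mass_le_triangle_side.
  - by rewrite /dot /=; ring.
  - by rewrite /dot /=; ring.
  - by rewrite /dot /=; ring.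
  - rewrite (_ : cross _ _ = - (d * e)); last by rewrite /cross /=; ring.
    by rewrite normrN ger0_norm.
  - by move=> i im; exists i, 0%N; rewrite addn0; split => //; rewrite /lin2 /=;
    congr pair; ring.
have nE : (s * (e / 2)) ^+ 2 + (e / 2) ^+ 2 = e ^+ 2.
  by rewrite (_ : _ + _ = (s * s + 1) * e ^+ 2 / 4); [rewrite s2; field|field].
have tE : (d / 2) ^+ 2 + (s * (d / 2)) ^+ 2 = d ^+ 2.
  by rewrite (_ : _ + _ = (s * s + 1) * d ^+ 2 / 4); [rewrite s2; field|field].
have Q2 : Q [set x | exists a b : R, [/\ 0 <= b <= e, - s * b <= a, a <= 1 - 2 * s * e + s * b &
    x = lin2 (1 - s * e, e) (- (d / 2), s * (d / 2)) (s * (e / 2), e / 2) (a / d)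
      (b / e)]] side_cost.
  apply: mass_le_triangle_side.
  - by rewrite -tE /dot /=; ring.
  - by rewrite -nE /dot /=; ring.
  - by rewrite /dot /=; ring.
  - rewrite (_ : cross _ _ = - (d * e * (1 + s * s) / 4)); last by rewrite /cross /=;
    field.
    by rewrite s2 normrN ger0_norm; [field | rewrite divr_ge0 // mulr_ge0].
  - move=> i im; exists (m - i)%N, i; split; first by rewrite subnK.
    rewrite /lin2 /= natrB //; congr pair; last by field.
    by rewrite (_ : s * e + (m%:R - i%:R) * d + i%:R * (d / 2) = s * e +
      m%:R * d - i%:R * (d / 2)); [rewrite mdE; ring|field].
have Q3 : Q [set x | exists a b : R, [/\ 0 <= b <= e, - s * b <= a, a <= 1 - 2 * s * e + s * b &
    x = lin2 (1 / 2, s / 2 - 2 * e) (- (d / 2), - (s * (d / 2)))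
      (- (s * (e / 2)), e / 2) (a / d) (b / e)]] side_cost.
  apply: mass_le_triangle_side.
  - by rewrite -tE /dot /=; ring.
  - by rewrite -nE /dot /=; ring.
  - by rewrite /dot /=; ring.
  - rewrite (_ : cross _ _ = - (d * e * (1 + s * s) / 4)); last by rewrite /cross /=;
    field.
    by rewrite s2 normrN ger0_norm; [field | rewrite divr_ge0 // mulr_ge0].
  - move=> i im; exists 0%N, (m - i)%N; split; first by rewrite leq_subr.
    rewrite /lin2 /= natrB //; congr pair.
      rewrite (_ : s * e + 0 * d + (m%:R - i%:R) * (d / 2) = s * e +
        (m%:R * d) / 2 - i%:R * (d / 2)); last by field.
      by rewrite mdE; field.
    rewrite (_ : e + 0 * 0 + (m%:R - i%:R) * (d * s / 2) = e +
      (m%:R * d) * s / 2 - i%:R * (d * s / 2)); last by field.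
    rewrite mdE (_ : e + (1 - 2 * s * e) * s / 2 - i%:R * (d * s / 2) = e +
      s / 2 - (s * s) * e - i%:R * (d * s / 2)); last by field.
    by rewrite s2; field.
have U := mass_leU (mindist sites) (mindist_ge0 _) (measurable_mindist _).
apply: mass_le_sub (U _ _ _ _ Q0 (U _ _ _ _ Q1 (U _ _ _ _ Q2 Q3))); last first.
  by rewrite le_eqVlt; apply/predU1l; ring.
move=> [x y]; rewrite /triangle /= -/s => -[y0 [yl yr]].
have dn0 : d != 0 by rewrite gt_eqF.
have en0 : e != 0 by rewrite gt_eqF.
(* Linear arithmetic sees products with [s] as atoms, so instances of [s * s = 3] are supplied, and
   inequalities are multiplied by [s] beforehand. *)
have s2x : s * (s * x) = 3 * x by rewrite mulrA s2.
have s2e : s * (s * e) = 3 * e by rewrite mulrA s2.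
have s2y : s * (s * y) = 3 * y by rewrite mulrA s2.
have sM (z : R) : 0 <= z -> 0 <= s * z by move=> z0; rewrite mulr_ge0 // ltW.
have s2' : s * (s * 1) = 3 by rewrite mulr1.
(* The distances to the left and right sides; [y] is the distance to the bottom. *)
pose hl := (s * x - y) / 2; pose hr := (s * (1 - x) - y) / 2.
have Kb : 0 <= s * (hl - y) -> 0 <= s * (hr - y) -> y <= e ->
    exists a b : R, [/\ 0 <= b <= e, - s * b <= a, a <= 1 - 2 * s * e + s * b &
    (x, y) = lin2 (s * e, e) (d, 0) (0, - e) (a / d) (b / e)].
  rewrite /hl /hr => H1 H2 H3; exists (x - s * e), (e - y); split.
  - by apply/andP; split; lra.
  - lra.
  - lra.
  - by rewrite /lin2 /=; congr pair; field; rewrite ?dn0 ?en0.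
have Kr : 0 <= s * (y - hr) -> 0 <= s * (hl - hr) -> hr <= e ->
    exists a b : R, [/\ 0 <= b <= e, - s * b <= a, a <= 1 - 2 * s * e + s * b &
    (x, y) = lin2 (1 - s * e, e) (- (d / 2), s * (d / 2)) (s * (e / 2), e / 2) (a / d)
      (b / e)].
  move=> H1 H2 H3; exists ((1 - x + s * y - 2 * s * e) / 2), (e - hr); split.
  - by apply/andP; split; rewrite /hr in H3 *; lra.
  - by rewrite /hr /hl in H1 H2 *; lra.
  - by rewrite /hr /hl in H1 H2 *; lra.
  (* These identities hold only modulo [s * s = 3], so the residue is exhibited as a multiple of
     [s * s - 3]. *)
  - rewrite /lin2 /= /hr; congr pair.
      by rewrite [RHS](_ : _ = x - (s * s - 3) * (1 - x) / 4); [rewrite s2;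
        field|field; rewrite ?dn0 ?en0].
    by rewrite [RHS](_ : _ = y + (s * s - 3) * (y - 2 * e) / 4); [rewrite s2;
      field|field; rewrite ?dn0 ?en0].
have Kl : 0 <= s * (y - hl) -> 0 <= s * (hr - hl) -> hl <= e ->
    exists a b : R, [/\ 0 <= b <= e, - s * b <= a, a <= 1 - 2 * s * e + s * b &
    (x, y) = lin2 (1 / 2, s / 2 - 2 * e) (- (d / 2), - (s * (d / 2)))
      (- (s * (e / 2)), e / 2)
       (a / d) (b / e)].
  move=> H1 H2 H3; exists ((2 - x - s * y - 2 * s * e) / 2), (e - hl); split.
  - by apply/andP; split; rewrite /hl in H3 *; lra.
  - by rewrite /hr /hl in H1 H2 *; lra.
  - by rewrite /hr /hl in H1 H2 *; lra.
  - rewrite /lin2 /= /hl; congr pair.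
      by rewrite [RHS](_ : _ = x + (s * s - 3) * x / 4); [rewrite s2; field|field;
        rewrite ?dn0 ?en0].
    by rewrite [RHS](_ : _ = y + (s * s - 3) * (y + 2 * e) / 4); [rewrite s2;
      field|field; rewrite ?dn0 ?en0].
have Kin : e <= y -> e <= hl -> e <= hr -> exists a b : R,
    [/\ 0 <= a, 0 <= b, a + b <= m%:R & (x, y) = lin2 V t1 t2 a b].
  move=> H1 H2 H3.
  have K1 : 0 <= s * (y - e) by rewrite sM // subr_ge0.
  have K2 : 0 <= s * (hl - e) by rewrite sM // subr_ge0.
  have K3 : 0 <= s * (hr - e) by rewrite sM // subr_ge0.
  exists ((x - s * e - s * (y - e) / 3) / d), (2 * s * (y - e) / 3 / d); split.
  - by apply: divr_ge0 (ltW d0); rewrite /hl in K2; lra.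
  - by apply: divr_ge0 (ltW d0); lra.
  - rewrite mE -mulrDl ler_wpM2r ?invr_ge0 ?(ltW d0) //.
    by rewrite /hr in K3; lra.
  - rewrite /lin2 /=; congr pair; first by field.
    rewrite [RHS](_ : _ = e + (s * s) * (y - e) / 3); last by field.
    by rewrite s2; field.
have : y <= hl /\ y <= hr \/ hr <= y /\ hr <= hl \/ hl <= y /\ hl <= hr.
  have [yhl|/ltW hly] := leP y hl.
    have [yhr|/ltW hry] := leP y hr; first by left.
    by right; left; split => //; exact: le_trans yhl.
  have [hlr|/ltW hrl] := leP hl hr; first by right; right.
  by right; left; split => //; exact: le_trans hly.
move=> [[h1 h2]|[[h1 h2]|[h1 h2]]].
- have [ey|/ltW ye] := leP e y; first by left; apply: Kin; rewrite // (le_trans ey).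
  by right; left; apply: Kb => //; rewrite sM // subr_ge0.
- have [er|/ltW re] := leP e hr; first by left; apply: Kin; rewrite // (le_trans er).
  by right; right; left; apply: Kr => //; rewrite sM // subr_ge0.
- have [el|/ltW le] := leP e hl; first by left; apply: Kin; rewrite // (le_trans el).
  by right; right; right; apply: Kl => //; rewrite sM // subr_ge0.
Qed.

End Lattice.

(** * Evaluation of the cost and its asymptotics *)

Lemma distortion_sites_eq {R : realType} (n s w : R) : 0 < n - 1 -> s != 0 -> s * s = 3 ->
  w ^+ 2 = 21 ->
  let u := w / 3 in let m := n - 1 in
  let d := (n - u) / (n * m) in let e := u * s / (6 * n) in
  4 / s * (m ^+ 2 * (5 * s / 144 * d ^+ 4) +
    3 * (m * (d * e / 3 * (d ^+ 2 / 4 + e ^+ 2)) + s * (e ^+ 2) ^+ 2)) =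
  (45 * n ^+ 3 - 28 * w * n ^+ 2 + (301 - 28 * w) * n - 98)
  / (324 * n ^+ 3 * m ^+ 2).
Proof.
move=> n1 s0 s2 w2 u m d e.
have u2 : u ^+ 2 - 7 / 3 = 0 by rewrite /u expr_div_n w2; field.
have n0 : n != 0 by rewrite gt_eqF //; lra.
have m0 : m != 0 by rewrite gt_eqF.
have e2 : e ^+ 2 = u ^+ 2 / (12 * n ^+ 2).
  rewrite (_ : e ^+ 2 = u ^+ 2 * (s * s) / (36 * n ^+ 2)); last by rewrite /e; field.
  by rewrite s2; field.
rewrite e2 (_ : w = 3 * u); last by rewrite /u; field.
(* For general [u] the [n ^ 3] coefficient of this numerator is [18 u ^ 3 - 126 u], smallest among
   positive [u] at [u ^ 2 = 7 / 3]. *)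
transitivity ((45 * (n - u) ^+ 4 + 54 * u * (n - u) ^+ 3 + 18 * m ^+ 2 * (n - u) * u ^+ 3
   + 27 * m ^+ 2 * u ^+ 4) / (324 * n ^+ 4 * m ^+ 2)).
  by rewrite /d /e; field; rewrite s0 n0 m0.
(* Modulo [u ^ 2 - 7 / 3] the numerator is divisible by [n], which lowers [n ^ 4] to [n ^ 3] in the
   denominator. *)
rewrite (_ : 45 * _ + _ + _ + _ =
  n * (45 * n ^+ 3 - 28 * (3 * u) * n ^+ 2 + (301 - 28 * (3 * u)) * n - 98)
  + (u ^+ 2 - 7 / 3) * ((9 * m ^+ 2 - 9) * (u ^+ 2 + 7 / 3) +
    (18 * m ^+ 2 * n - 18 * n) * u
     + 108 * n ^+ 2)); last by rewrite /m; field.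
by rewrite u2 mul0r addr0; field; rewrite n0 m0.
Qed.

(** The two main terms cancel the numerator down to degree one in [n], against degree five below.
    The constants are crude: [0 <= w <= 5] bounds the numerator, and [n >= 2] compares [(n - 1) ^ 2]
    with [n ^ 2]. *)
Lemma tri_bound_asymptotic {R : realType} (N : nat) : (2 <= N)%N ->
  `| tri_bound R N
     - (5 / (36 * N%:R ^+ 2) - (14 * Num.sqrt 21 - 45) / (162 * N%:R ^+ 3)) |
  <= 100 / N%:R ^+ 4.
Proof.
move=> N2; rewrite /tri_bound; set w := Num.sqrt 21; set n : R := N%:R.
have n2 : 2 <= n by rewrite ler_nat.
have w0 : 0 <= w by rewrite sqrtr_ge0.
have w2 : w ^+ 2 = 21 by rewrite sqr_sqrtr.
have w5 : w <= 5 by rewrite -(@ler_pXn2r _ 2) // ?nnegrE // w2; lra.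
have n0 : n != 0 by rewrite gt_eqF //; lra.
have m0 : n - 1 != 0 by rewrite gt_eqF //; lra.
rewrite [X in `|X|](_ : _ = ((436 - 84 * w) * n +
  (28 * w - 188)) / (324 * n ^+ 3 * (n - 1) ^+ 2)); last first.
  by field; rewrite n0 m0.
have p0 : 0 < 324 * n ^+ 3 * (n - 1) ^+ 2.
  by rewrite !mulr_gt0 // ?exprn_gt0 //; lra.
have q0 : 0 < n ^+ 4 by rewrite exprn_gt0 //; lra.
rewrite normrM normfV (gtr0_norm p0) ler_pdivrMr // mulrAC ler_pdivlMr //.
have H : `|(436 - 84 * w) * n + (28 * w - 188)| <= 1000 * n.
  by rewrite ler_norml; apply/andP; split; nra.
apply: le_trans (_ : 1000 * n * n ^+ 4 <= _); first by rewrite ler_wpM2r // ltW.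
rewrite (_ : 1000 * n * n ^+ 4 = n ^+ 3 * (1000 * n ^+ 2)); last by ring.
rewrite [leRHS](_ : _ = n ^+ 3 * (100 * (324 * (n - 1) ^+ 2))); last by ring.
by rewrite ler_wpM2l ?exprn_ge0 //; nra.
Qed.

Theorem theorem6p3 (R : realType) :
  (forall N : nat, (3 <= N)%N ->
     (Vn R (N * N.+1 %/ 2) <= (tri_bound R N)%:E)%E) /\
  (exists C : R, exists M : nat, forall N : nat, (M <= N)%N ->
     `| tri_bound R N
        - (5 / (36 * N%:R ^+ 2) - (14 * Num.sqrt 21 - 45) / (162 * N%:R ^+ 3)) |
     <= C / N%:R ^+ 4).
Proof.
split; last by exists 100, 2%N => N; exact: tri_bound_asymptotic.
move=> N N3.
pose n : R := N%:R; pose s : R := Num.sqrt 3; pose w : R := Num.sqrt 21; pose u := w / 3.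
have n3 : 3 <= n by rewrite ler_nat.
have s0 : 0 < s by rewrite sqrtr_gt0.
have s2 : s * s = 3 by rewrite -expr2 sqr_sqrtr.
have w2 : w ^+ 2 = 21 by rewrite sqr_sqrtr.
have w0 : 0 < w by rewrite sqrtr_gt0.
have w5 : w <= 5 by rewrite -(@ler_pXn2r _ 2) // ?nnegrE ?ltW // w2; lra.
have mE : N.-1%:R = n - 1 :> R by rewrite -subn1 natrB //; lia.
(* This [e] gives [2 * s * e = u / n], and [d] is then forced by [mde]; it is positive because
   [u <= 5 / 3 < n]. *)
pose d := (n - u) / (n * (n - 1)); pose e := u * s / (6 * n).
have d0 : 0 < d by rewrite divr_gt0 ?mulr_gt0 // /u; lra.
have e0 : 0 < e by rewrite divr_gt0 ?mulr_gt0 //; lra.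
have n0 : n != 0 by rewrite gt_eqF //; lra.
have m0 : n - 1 != 0 by rewrite gt_eqF //; lra.
have mde : N.-1%:R * d + 2 * s * e = 1.
  rewrite mE (_ : 2 * s * e = u * (s * s) / (3 * n)); last by rewrite /e; field.
  rewrite s2 /d.
  by field; rewrite n0 m0.
have Q := mass_le_big_triangle N d e N3 d0 e0 mde.
apply: le_trans (_ : distortion (sites N d e) <= _)%E.
  by apply: ereal_inf_lbound; exists (sites N d e) => //=; rewrite size_sites.
apply: le_trans (distortion_le _ _ Q) _.
rewrite lee_fin mE le_eqVlt; apply/orP; left; apply/eqP.
by apply: distortion_sites_eq; rewrite ?gt_eqF //; lra.
Qed.
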